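(* Let $(\mathfrak{D},\preceq,\bot,\top)$ be a system model, $\mathbf{T}=(T,\alpha)$ a test setup for it, and $A\subseteq\mathfrak{D}$ an assumption. If a requirement $R\subseteq\mathfrak{D}$ is $\mathbf{T}$-refutable under $A$, then there exists a prohibition $P_{R\mid A}\subseteq\mathfrak{D}$ such that for all $S\in A$: $S\notin P_{R\mid A}$ if and only if $S\notin R$. Namely, $P_{R\mid A}=\lfloor A\cap R\rfloor$ is such a prohibition.
   Context: A system model is a tuple $(\mathfrak{D},\preceq,\bot,\top)$ where $\mathfrak{D}$ is a nonempty set (of systems), $\preceq$ is a partial order on $\mathfrak{D}$ (refinement), $\bot$ is the least element and $\top$ the greatest element. Requirements and assumptions are subsets of $\mathfrak{D}$. For a set $R\subseteq\mathfrak{D}$, $\lfloor R\rfloor=\bigcup_{S\in R}\{S'\in\mathfrak{D}\mid S'\preceq S\}$ (so $\lfloor\emptyset\rfloor=\emptyset$). A requirement $R$ is a prohibition if it is refinement-closed: for all $S,S'\in\mathfrak{D}$, $S\in R$ and $S'\preceq S$ imply $S'\in R$ (equivalently $R=\lfloor R\rfloor$). A test setup is a pair $\mathbf{T}=(T,\alpha)$ where $T$ is a set (of observations) and $\alpha:\mathfrak{D}\to 2^T$ is order-preserving: $S\preceq S'$ implies $\alpha(S)\subseteq\alpha(S')$. For $t\in T$, $\hat\alpha(t)=\{S\in\mathfrak{D}\mid t\in\alpha(S)\}$. A requirement $R$ is $\mathbf{T}$-refutable under $A$ if for every $S\in A$ with $S\notin R$ there exists $t\in\alpha(S)$ with $(\hat\alpha(t)\cap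 A)\cap R=\emptyset$. *)

(* Defs.v *)
From mathcomp Require Import all_boot all_order.
From mathcomp Require Import boolp classical_sets.

Set Implicit Arguments.
Unset Strict Implicit.
Unset Printing Implicit Defensive.

Local Open Scope classical_set_scope.
Local Open Scope order_scope.

(* A system model is a [tbPOrderType]: a partial order (refinement) with a
   least element [\bot] and a greatest element [\top]; it is thus nonempty.
   Classically, the boolean order relation and the choice structure carried by
   [tbPOrderType] restrict neither the carrier nor the order.
   Requirements and assumptions are arbitrary sets [set D]. *)

Section SystemModel.
Context {d : Order.disp_t} {D : tbPOrderType d}.
Implicit Types R A : set D.

Definition refinement_closure R : set D :=
  \bigcup_(S in R) [set S' | S' <= S].

Lemma refinement_closureE R : refinement_closure R = down R.
Proof.
by apply/seteqP; split=> x [S]; [move=> RS xS; exists S | case=> RS xS; exists S].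
Qed.

Definition prohibition R : Prop := forall S S' : D, R S -> S' <= S -> R S'.

End SystemModel.

Record test_setup (d : Order.disp_t) (D : tbPOrderType d) := TestSetup {
  observation : Type;
  alpha : D -> set observation;
  alpha_homo : forall S S' : D, S <= S' -> alpha S `<=` alpha S'
}.
Arguments observation {d D} T : rename.
Arguments alpha {d D} T S : rename.

Section TestSetup.
Context {d : Order.disp_t} {D : tbPOrderType d}.

Definition alpha_hat (T : test_setup D) (t : observation T) : set D :=
  [set S | alpha T S t].

Definition refutable (T : test_setup D) (A R : set D) : Prop :=
  forall S : D, A S -> ~ R S ->
    exists2 t, alpha T S t & (alpha_hat t `&` A) `&` R = set0.

End TestSetup.

(* Main.v *)
(* If S in A lies below some S0 in A `&` R, every observation of S is also one
   of S0, hence none of them can refute R; so S is in R. *)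
Require Import Defs.
From mathcomp Require Import all_boot all_order.
From mathcomp Require Import boolp classical_sets.

Local Open Scope classical_set_scope.

(** Closing the intersection of [A] and [R] downwards adds no system of [A] outside [R]: such an [S]
    would have a refuting observation, which monotonicity of [alpha] passes up to a system of [A]
    meeting [R]. Transitivity of refinement makes the closure a prohibition. *)

Lemma prohibition_refinement_closure (d : Order.disp_t) (D : tbPOrderType d)
    (R : set D) : prohibition (refinement_closure R).
Proof.
by move=> S S' [S0 RS0 /= leS] leS'; exists S0 => //=; apply: Order.POrderTheory.le_trans leS.
Qed.

Lemma refutable_refinement_closure (d : Order.disp_t) (D : tbPOrderType d)
    (T : test_setup D) (A R : set D) (S : D) :
  refutable T A R -> A S -> refinement_closure (A `&` R) S <-> R S.
Proof.
move=> HR AS; split=> [[S0 [AS0 RS0] /= leS] | RS]; last first.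
  by exists S => //=; apply: Order.POrderTheory.lexx.
apply: contrapT => nRS; have [t tS tR0] := HR S AS nRS.
(* [S0] inherits the refuting [t] from its refinement [S], so it inhabits the set that [tR0]
   declares empty. *)
suff : set0 S0 by [].
by rewrite -tR0; split=> //; split=> //; apply: (alpha_homo leS).
Qed.

Theorem theorem3 (d : Order.disp_t) (D : tbPOrderType d) (T : test_setup D)
    (A R : set D) (HR : refutable T A R) :
  (exists P : set D,
      prohibition P /\ (forall S : D, A S -> (~ P S <-> ~ R S))) /\
  (prohibition (refinement_closure (A `&` R)) /\
   (forall S : D, A S -> (~ refinement_closure (A `&` R) S <-> ~ R S))).
Proof.
suff H : prohibition (refinement_closure (A `&` R)) /\
    (forall S : D, A S -> (~ refinement_closure (A `&` R) S <-> ~ R S)).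
  by split=> //; exists (refinement_closure (A `&` R)).
split=> [|S AS]; first exact: prohibition_refinement_closure.
by rewrite (propext (refutable_refinement_closure _ _ _ _ _ _ HR AS)).
Qed.
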